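(* Let $A$ be a $2n\times 2n$ real symmetric matrix. There exist a real symplectic matrix $M\in\operatorname{Sp}(2n)$ and an $n\times n$ real diagonal matrix $D$ such that $$M^{\top} A M = \begin{pmatrix} D & 0\\ 0 & D\end{pmatrix}$$ if and only if there exist symplectic subspaces $\mathscr{W}_-,\mathscr{W}_0,\mathscr{W}_+$ of $\mathbb{R}^{2n}$ such that all of the following hold: (i) $\mathscr{W}_-,\mathscr{W}_0,\mathscr{W}_+$ are pairwise symplectically orthogonal to each other and have dimensions $\nu(A),\xi(A),\pi(A)$, respectively; (ii) each of $\mathscr{W}_-,\mathscr{W}_0,\mathscr{W}_+$ is invariant under $JA$; (iii) $A$ is negative definite on $\mathscr{W}_-$, the kernel of $A$ is $\mathscr{W}_0$, and $A$ is positive definite on $\mathscr{W}_+$. When such a decomposition exists, the diagonal matrix $D$ is unique up to the ordering of its diagonal entries. Moreover, the diagonal entries of $D$ and $-D$ combined together constitute the $2n$ eigenvalues (counted with multiplicity) of $iJA$, where $i=\sqrt{-1}$.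
   Context: $J=J_{2n}=\begin{pmatrix}0&I_n\\-I_n&0\end{pmatrix}$. $\operatorname{Sp}(2n)$ is the set of $2n\times 2n$ real matrices $M$ with $M^{\top}JM=J$. $\langle x,y\rangle=x^{\top}y$. For a subset $\mathscr{X}\subseteq\mathbb{R}^{2n}$, its symplectic orthogonal complement is $\mathscr{X}^{\perp_{\operatorname{s}}}=\{u\in\mathbb{R}^{2n}:\langle u,Jv\rangle=0\ \forall v\in\mathscr{X}\}$. A linear subspace $\mathscr{W}$ is a symplectic subspace if $\mathscr{W}\cap\mathscr{W}^{\perp_{\operatorname{s}}}=\{0\}$ (the zero subspace is allowed). Two symplectic subspaces $\mathscr{W},\mathscr{Z}$ are symplectically orthogonal to each other if $\mathscr{Z}\subseteq\mathscr{W}^{\perp_{\operatorname{s}}}$. $\nu(A),\xi(A),\pi(A)$ denote the numbers of negative, zero, and positive eigenvalues of $A$, respectively, counted with multiplicity. $A$ is positive definite on $\mathscr{W}$ if $\langle w,Aw\rangle>0$ for all nonzero $w\in\mathscr{W}$, and negative definite on $\mathscr{W}$ if $-A$ is positive definite on $\mathscr{W}$. *)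

(* Defs.v *)
From HB Require Import structures.
From mathcomp Require Import all_boot all_order all_fingroup all_algebra.
From mathcomp Require Import all_classical reals.
From mathcomp Require Import polyrcf complex.

Set Implicit Arguments.
Unset Strict Implicit.
Unset Printing Implicit Defensive.

Import Order.TTheory GRing.Theory Num.Theory.
Local Open Scope classical_set_scope.
Local Open Scope ring_scope.

Definition Jmx (R : realType) (n : nat) : 'M[R]_(n + n) :=
  block_mx 0 1%:M (- 1%:M) 0.

Definition symplectic (R : realType) (n : nat) (M : 'M[R]_(n + n)) : Prop :=
  M^T *m Jmx R n *m M = Jmx R n.

Definition inner (R : realType) (m : nat) (x y : 'cV[R]_m) : R :=
  (x^T *m y) 0 0.

Definition symp_compl (R : realType) (n : nat) (X : set 'cV[R]_(n + n)) :
    set 'cV[R]_(n + n) :=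
  [set u | forall v, X v -> inner u (Jmx R n *m v) = 0].

Definition symp_subspace (R : realType) (n : nat)
    (W : {vspace 'cV[R]_(n + n)}) : Prop :=
  [set` W] `&` symp_compl [set` W] = [set 0].

Definition symp_orthogonal (R : realType) (n : nat)
    (W Z : {vspace 'cV[R]_(n + n)}) : Prop :=
  [set` Z] `<=` symp_compl [set` W].

Definition mxfun (R : realType) (m : nat) (B : 'M[R]_m) : 'End('cV[R]_m) :=
  linfun (mulmx B).

Definition mxinvariant (R : realType) (m : nat) (B : 'M[R]_m)
    (W : {vspace 'cV[R]_m}) : Prop :=
  (mxfun B @: W <= W)%VS.

Definition posdef_on (R : realType) (m : nat) (A : 'M[R]_m)
    (W : {vspace 'cV[R]_m}) : Prop :=
  forall w : 'cV[R]_m, w \in W -> w != 0 -> 0 < inner w (A *m w).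

Definition negdef_on (R : realType) (m : nat) (A : 'M[R]_m)
    (W : {vspace 'cV[R]_m}) : Prop :=
  posdef_on (- A) W.

(* rootsR lists each real root once; mup supplies its multiplicity. *)
Definition nb_eigen (R : realType) (m : nat) (P : pred R) (A : 'M[R]_m) : nat :=
  (\sum_(a <- rootsR (char_poly A) | P a) mup a (char_poly A))%N.

Definition nb_neg (R : realType) (m : nat) (A : 'M[R]_m) : nat :=
  nb_eigen (fun a => a < 0) A.

Definition nb_zero (R : realType) (m : nat) (A : 'M[R]_m) : nat :=
  nb_eigen (fun a => a == 0) A.

Definition nb_pos (R : realType) (m : nat) (A : 'M[R]_m) : nat :=
  nb_eigen (fun a => 0 < a) A.

Definition eigenvalues_are (F : fieldType) (m : nat) (B : 'M[F]_m) (s : seq F) :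
    Prop :=
  char_poly B = \prod_(z <- s) ('X - z%:P).

Definition iJmx (R : realType) (n : nat) (A : 'M[R]_(n + n)) :
    'M[R[i]]_(n + n) :=
  'i%C *: map_mx (real_complex R) (Jmx R n *m A).

(* An n x n diagonal matrix is encoded by the row d of its diagonal entries. *)
Definition symp_diagonalizes (R : realType) (n : nat) (A M : 'M[R]_(n + n))
    (d : 'rV[R]_n) : Prop :=
  symplectic M /\
  M^T *m A *m M = block_mx (diag_mx d) 0 0 (diag_mx d).

Definition symp_splitting (R : realType) (n : nat) (A : 'M[R]_(n + n))
    (Wm W0 Wp : {vspace 'cV[R]_(n + n)}) : Prop :=
  [/\ [/\ symp_subspace Wm, symp_subspace W0 & symp_subspace Wp],
      [/\ symp_orthogonal Wm W0, symp_orthogonal Wm Wp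
        & symp_orthogonal W0 Wp],
      [/\ \dim Wm = nb_neg A, \dim W0 = nb_zero A & \dim Wp = nb_pos A],
      [/\ mxinvariant (Jmx R n *m A) Wm, mxinvariant (Jmx R n *m A) W0
        & mxinvariant (Jmx R n *m A) Wp]
    & [/\ negdef_on A Wm, lker (mxfun A) = W0 & posdef_on A Wp]].

(* Main.v *)
Require Import Defs.
From HB Require Import structures.
From mathcomp Require Import all_boot all_order all_fingroup all_algebra.
From mathcomp Require Import all_classical reals.
From mathcomp Require Import polyrcf complex.
From mathcomp Require Import spectral.

Set Implicit Arguments.
Unset Strict Implicit.
Unset Printing Implicit Defensive.

Import Order.TTheory GRing.Theory Num.Theory.
Local Open Scope ring_scope.

(** Call a positive definite symmetric matrix S with A J S = S J A a taming of
    A.  The diagonal form, the splitting and the taming are equivalent data.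

    A symplectic M diagonalizing A conjugates J A into J E, where
    E = diag(d, d).  The columns of M sorted by the sign of their entry in E
    span the three subspaces: J exchanges the columns i and n + i, which carry
    the same entry, so each span is symplectic and J A-invariant, and the three
    are symplectically orthogonal.  Their dimensions are nu, xi and pi of A by
    Sylvester's law of inertia ([sylvester_inertia]), applied to the congruence
    of A with E on one side and with its spectral form on the other.

    Conversely, the dimensions add up to 2n, so the splitting is a direct sum,
    and the projections P-, P0, P+ commute with J A and are self-adjoint for
    the symplectic form.  Then S = A (P+ - P-) + P0^T P0 is a taming
    ([taming_of_splitting]).  Given a taming, A J and S J commute, so over the
    complex numbers they have a common eigenvector z in every nonzero subspace
    stable under both; and z S z^* > 0 forces z J z^* <> 0, so z spans a
    symplectic plane together with its conjugate.  Peeling off such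
    planes gives n rows Z with Z J Z^T = 0 and Z J Z^* = -2i ([symplectic_eigenrows]),
    and the real and imaginary parts of Z are the columns of a symplectic
    matrix that diagonalizes A ([diagonalizable_of_taming]).

    For uniqueness, two diagonal forms E and E' are related by an N which both
    transports the quadratic form, N^T E N = E', and intertwines the squares of
    J E and J E', that is E^2 N = N E'^2.  Hence N also transports the
    part of E supported where E^2 = c^2; on that part the entries are c or -c,
    and the law of inertia tells how many there are of each
    ([symp_diagonal_multiplicity]).  Finally J E has 2 x 2 blocks with
    eigenvalues +-i d_j, which gives the spectrum of i J A. *)

Local Open Scope sesquilinear_scope.

Local Notation cx R := (map_mx (real_complex R)).

(** * Sylvester's law of inertia *)

(** Both conditions on x are linear, and there are (k - #|p|) + #|q| < k of
    them.  This is the dimension count behind the law of inertia: it produces a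
    vector on which two forms with incompatible signatures would disagree. *)
Lemma prescribed_zeros (F : fieldType) k m (Q : 'M[F]_(k, m))
    (p : pred 'I_k) (q : pred 'I_m) :
  (#|q| < #|p|)%N ->
  exists x : 'rV_k, [/\ x != 0, forall i, ~~ p i -> x 0 i = 0
    & forall j, q j -> (x *m Q) 0 j = 0].
Proof.
move=> ltqp.
pose B := row_mx (colsub (@enum_val _ (predC p)) 1%:M) (colsub (@enum_val _ q) Q).
have : kermx B != 0.
  rewrite -mxrank_eq0 mxrank_ker subn_eq0 -ltnNge.
  apply: leq_ltn_trans (rank_leq_col _) _.
  by rewrite -[X in (_ < X)%N](card_ord k) -(cardC p) addnC ltn_add2r.
case/rowV0Pn => x /sub_kermxP; rewrite mul_mx_row -[0]row_mx0.
case/eq_row_mx => xp xq x0; exists x; split=> // [i npi|j qj].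
  have ip : i \in predC p by [].
  move/rowP/(_ (enum_rank_in ip i)): xp.
  by rewrite mulmx_colsub mulmx1 !mxE enum_rankK_in.
have jq : j \in q by [].
move/rowP/(_ (enum_rank_in jq j)): xq.
by rewrite mulmx_colsub mxE [RHS]mxE enum_rankK_in.
Qed.

Lemma quad_diag (C : numClosedFieldType) m (b x : 'rV[C]_m) :
  (x *m diag_mx b *m x ^t*) 0 0 = \sum_j b 0 j * `|x 0 j| ^+ 2.
Proof.
rewrite mxE; apply: eq_bigr => j _.
by rewrite mul_mx_diag !mxE normCK mulrAC mulrC.
Qed.

(** If a had more positive entries than b, some nonzero x supported on the
    positive entries of a would have x Q vanish on those of b; the common value
    of the two forms at x would be both positive and nonpositive.  Q is
    arbitrary, so that the reverse inequality is the same lemma for the inverse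
    of Q. *)
Lemma inertia_le (C : numClosedFieldType) k m (a : 'rV[C]_k) (b : 'rV[C]_m)
    (Q : 'M[C]_(k, m)) :
  (forall j, b 0 j \is Num.real) -> diag_mx a = Q *m diag_mx b *m Q ^t* ->
  (#|[pred i | (0 < a 0 i)%R]| <= #|[pred j | (0 < b 0 j)%R]|)%N.
Proof.
move=> breal aE; rewrite leqNgt; apply/negP.
case/(prescribed_zeros Q) => x [x0 xa xb].
have : (x *m diag_mx a *m x ^t*) 0 0 <= 0.
  have -> : x *m diag_mx a *m x ^t* = (x *m Q) *m diag_mx b *m (x *m Q) ^t*.
    by rewrite aE trmx_mul map_mxM !mulmxA.
  rewrite quad_diag -oppr_ge0 -sumrN sumr_ge0 // => j _.
  case: (boolP (0 < b 0 j)) => [/xb ->|].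
    by rewrite normr0 expr0n mulr0 oppr0.
  by rewrite -real_leNgt // => bj; rewrite -mulNr mulr_ge0 ?oppr_ge0 ?exprn_ge0.
apply/negP; rewrite quad_diag; have [i xi] : exists i, x 0 i != 0.
  by apply/rV0Pn.
have ai : 0 < a 0 i by apply: contraNT xi => /xa ->.
rewrite (bigD1 i) //= lt_geF // ltr_wpDr ?mulr_gt0 ?exprn_gt0 ?normr_gt0 //.
apply: sumr_ge0 => j _.
case: (boolP (0 < a 0 j)) => [aj|/xa ->]; last by rewrite normr0 expr0n mulr0.
by rewrite mulr_ge0 ?exprn_ge0 // ltW.
Qed.

Lemma inertia_eq (C : numClosedFieldType) m (a b : 'rV[C]_m) (Q : 'M[C]_m) :
    (forall i, a 0 i \is Num.real) -> (forall j, b 0 j \is Num.real) ->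
    Q \in unitmx -> diag_mx a = Q *m diag_mx b *m Q ^t* ->
  #|[pred i | (0 < a 0 i)%R]| = #|[pred j | (0 < b 0 j)%R]|.
Proof.
move=> areal breal uQ aE; apply/eqP; rewrite eqn_leq (inertia_le breal aE) /=.
apply: (inertia_le (Q := invmx Q)) => //; rewrite aE -!mulmxA mulKmx //.
by rewrite -map_mxM -trmx_mul mulVmx // trmx1 map_mx1 mulmx1.
Qed.

(** Translates the count of distinct real roots weighted by multiplicity into a
    count of indices, which is how eigenvalues appear in a spectral
    decomposition. *)
Lemma nb_eigen_roots (R : realType) m (A : 'M[R]_m) (l : 'rV[R]_m) (P : pred R) :
  char_poly A = \prod_j ('X - (l 0 j)%:P) ->
  nb_eigen P A = #|[pred j | P (l 0 j)]|.
Proof.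
move=> cE; rewrite /nb_eigen.
have -> : char_poly A = \prod_(a <- [seq l 0 j | j <- enum 'I_m]) ('X - a%:P).
  by rewrite cE big_map big_enum.
set s := [seq _ | _ <- _].
have s0 : \prod_(a <- s) ('X - a%:P) != 0.
  by rewrite monic_neq0 // monic_prod_XsubC.
have rE a : (a \in rootsR (\prod_(a <- s) ('X - a%:P))) = (a \in s).
  by rewrite -roots_on_rootsR // -root_prod_XsubC andbC andbT.
transitivity (count P s); last first.
  by rewrite count_map -sum1_count big_enum_cond sum1_card; apply: eq_card.
have us : perm_eq (rootsR (\prod_(a <- s) ('X - a%:P))) (undup s).
  apply: uniq_perm; rewrite ?undup_uniq ?uniq_roots //.
  by move=> a; rewrite rE mem_undup.
rewrite (perm_big _ us) /= -sum1_count -[RHS]big_undup_iterop_count.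
apply: eq_bigr => a _.
by rewrite mu_prod_XsubC Monoid.iteropE iter_addn mul1n addn0.
Qed.

Lemma char_poly_similar (F : fieldType) m (P A B : 'M[F]_m) :
  P \in unitmx -> P *m A = B *m P -> char_poly A = char_poly B.
Proof.
move=> uP PAB; have dP : \det (map_mx polyC P) != 0.
  by rewrite det_map_mx polyC_eq0 -unitfE -unitmxE.
apply: (mulfI dP); rewrite /char_poly -det_mulmx mulrC -det_mulmx.
congr (\det _); rewrite /char_poly_mx mulmxBr mulmxBl.
by rewrite scalar_mxC -!map_mxM PAB.
Qed.

Lemma conj_cx (R : rcfType) m n (A : 'M[R]_(m, n)) :
  map_mx Num.conj (cx R A) = cx R A.
Proof. by apply/matrixP => i j; rewrite !mxE; apply: conjc_real. Qed.

(** The spectral theorem for normal complex matrices gives a unitary P; the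
    diagonal is real because a real symmetric matrix is Hermitian, so its
    characteristic polynomial already splits over R. *)
Lemma real_spectral (R : rcfType) m (A : 'M[R]_m) : A^T = A ->
  exists (l : 'rV[R]_m) (P : 'M[R[i]]_m),
    [/\ P \in unitmx, cx R A = P ^t* *m diag_mx (cx R l) *m P
      & char_poly A = \prod_j ('X - (l 0 j)%:P)].
Proof.
move=> symA; have Ah : cx R A \is hermsymmx.
  by apply/is_hermitianmxP; rewrite expr0 scale1r map_trmx symA conj_cx.
have /orthomx_spectralP AE := hermitian_normalmx Ah.
have /mxOverP lreal := hermitian_spectral_diag_real Ah.
set P := spectralmx _ in AE; set l := spectral_diag _ in AE lreal.
have uP : P \in unitmx := spectral_unit _.
pose r : 'rV[R]_m := map_mx (@complex.Re R) l.
have lE : l = cx R r.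
  by apply/matrixP => i j; rewrite !mxE; apply/esym/RRe_real/lreal.
exists r, P; split=> //.
  by rewrite -invmx_unitary ?spectral_unitarymx // -lE.
have: map_poly (real_complex R) (char_poly A) =
    map_poly (real_complex R) (\prod_j ('X - (r 0 j)%:P)).
  rewrite map_char_poly AE.
  have -> : char_poly (invmx P *m diag_mx l *m P) = char_poly (diag_mx l).
    by apply: (char_poly_similar uP); rewrite -mulmxA mulKVmx.
  rewrite char_poly_trig ?diag_mx_is_trig // rmorph_prod /=.
  apply: eq_bigr => j _.
  by rewrite lE !mxE eqxx rmorphB /= map_polyX map_polyC.
by apply: map_poly_inj.
Qed.

Lemma sign_partition (R : realType) m (e : 'rV[R]_m) :
  (#|[pred j | (e 0 j < 0)%R]| + #|[pred j | (e 0 j == 0)%R]|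
   + #|[pred j | (0 < e 0 j)%R]|)%N = m.
Proof.
rewrite -[RHS](card_ord m) -(cardC [pred j | (0 < e 0 j)%R]) addnC; congr addn.
rewrite -(cardID [pred j | (e 0 j < 0)%R] (predC _)); congr addn.
  by apply: eq_card => j; rewrite !inE; case: ltgtP.
by apply: eq_card => j; rewrite !inE; case: ltgtP.
Qed.

(** Over C, the diagonal matrix of e is congruent to the spectral diagonal l of
    A through P M, so e and l have the same number of positive entries; applied
    to - e and - l this counts the negative ones, and the zeros are what
    remains. *)
Lemma sylvester_inertia (R : realType) m (A M : 'M[R]_m) (e : 'rV[R]_m) :
    A^T = A -> M \in unitmx -> M^T *m A *m M = diag_mx e ->
  [/\ nb_neg A = #|[pred j | (e 0 j < 0)%R]|,
      nb_zero A = #|[pred j | (e 0 j == 0)%R]|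
    & nb_pos A = #|[pred j | (0 < e 0 j)%R]|].
Proof.
move=> symA uM eE; have [l [P [uP AE cE]]] := real_spectral symA.
rewrite /nb_neg /nb_zero /nb_pos !(nb_eigen_roots _ cE).
pose Q := (P *m cx R M) ^t*.
have uQ : Q \in unitmx.
  by rewrite map_unitmx unitmx_tr unitmx_mul uP map_unitmx.
have QE : diag_mx (cx R e) = Q *m diag_mx (cx R l) *m Q ^t*.
  rewrite -map_diag_mx -eE !map_mxM AE /Q trmxCK trmx_mul map_mxM.
  by rewrite !map_trmx conj_cx !mulmxA.
have real j (v : 'rV[R]_m) : cx R v 0 j \is Num.real.
  by rewrite mxE; apply/complex_realP; exists (v 0 j).
have pos : #|[pred j | (0 < l 0 j)%R]| = #|[pred j | (0 < e 0 j)%R]|.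
  have := inertia_eq (real^~ e) (real^~ l) uQ QE.
  rewrite (eq_card (B := [pred j | (0 < e 0 j)%R])) => [->|j]; last first.
    by rewrite !inE mxE ltcR.
  by apply/esym/eq_card => j; rewrite !inE mxE ltcR.
have neg : #|[pred j | (l 0 j < 0)%R]| = #|[pred j | (e 0 j < 0)%R]|.
  have QN : diag_mx (cx R (- e)) = Q *m diag_mx (cx R (- l)) *m Q ^t*.
    have dN (v : 'rV[R]_m) : diag_mx (cx R (- v)) = - diag_mx (cx R v).
      by apply/matrixP => i j; rewrite !mxE rmorphN mulNrn.
    by rewrite !dN mulmxN mulNmx QE.
  have := inertia_eq (real^~ (- e)) (real^~ (- l)) uQ QN.
  rewrite (eq_card (B := [pred j | (e 0 j < 0)%R])) => [->|j]; last first.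
    by rewrite !inE !mxE ltcR oppr_gt0.
  by apply/esym/eq_card => j; rewrite !inE !mxE ltcR oppr_gt0.
split=> //; have := etrans (sign_partition l) (esym (sign_partition e)).
by rewrite pos neg => /addIn/addnI.
Qed.

Lemma nb_eigen_sum (R : realType) m (A : 'M[R]_m) : A^T = A ->
  (nb_neg A + nb_zero A + nb_pos A)%N = m.
Proof.
case/real_spectral => l [_ [_ _ cE]].
by rewrite /nb_neg /nb_zero /nb_pos !(nb_eigen_roots _ cE) sign_partition.
Qed.

Lemma inertia_diag (R : realType) m (e : 'rV[R]_m) :
  [/\ nb_neg (diag_mx e) = #|[pred j | (e 0 j < 0)%R]|,
      nb_zero (diag_mx e) = #|[pred j | (e 0 j == 0)%R]|
    & nb_pos (diag_mx e) = #|[pred j | (0 < e 0 j)%R]|].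
Proof.
apply: (sylvester_inertia (M := 1%:M)); rewrite ?tr_diag_mx ?unitmx1 //.
by rewrite trmx1 mul1mx mulmx1.
Qed.

(** * The symplectic form *)

Section Inner.
Variables (R : realType) (m : nat).
Implicit Types (x y z : 'cV[R]_m) (B C : 'M[R]_m).

Lemma innerE x y : inner x y = \sum_i x i 0 * y i 0.
Proof. by rewrite /inner mxE; apply: eq_bigr => i _; rewrite mxE. Qed.

Lemma inner_mul B C x y :
  inner (B *m x) (C *m y) = inner x (B^T *m C *m y).
Proof. by rewrite /inner trmx_mul !mulmxA. Qed.

Lemma inner_eq0 x : inner x x = 0 -> x = 0.
Proof.
rewrite innerE => x0; apply/colP => i; rewrite mxE.
have ge0 j : true -> 0 <= x j 0 * x j 0 by move=> _; rewrite -expr2 sqr_ge0.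
have /eqP := psumr_eq0P ge0 x0 (i := i) isT.
by rewrite mulf_eq0 orbb => /eqP.
Qed.

Lemma innerC x y : inner x y = inner y x.
Proof. by rewrite !innerE; apply: eq_bigr => i _; rewrite mulrC. Qed.

Lemma innerDl x y z : inner (x + y) z = inner x z + inner y z.
Proof. by rewrite /inner linearD /= mulmxDl mxE. Qed.

Lemma innerDr x y z : inner x (y + z) = inner x y + inner x z.
Proof. by rewrite /inner mulmxDr mxE. Qed.

Lemma innerNr x y : inner x (- y) = - inner x y.
Proof. by rewrite /inner mulmxN mxE. Qed.

Lemma inner_mulr B x y :
  inner x (B *m y) = inner (B^T *m x) y.
Proof. by rewrite /inner trmx_mul trmxK mulmxA. Qed.

Lemma inner_inj B C :
  (forall x y, inner x (B *m y) = inner x (C *m y)) -> B = C.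
Proof.
move=> BD; apply/eqP; rewrite -subr_eq0; apply/eqP/matrixP => i j.
have := BD (delta_mx i 0) (delta_mx j 0).
rewrite /inner trmx_delta -!colE -!rowE !mxE => ->.
by rewrite subrr.
Qed.

End Inner.

Section SymplecticMatrices.
Variables (R : realType) (n : nat).
Local Notation J := (Jmx R n).

Lemma tr_Jmx : J^T = - J.
Proof.
by rewrite /Jmx tr_block_mx opp_block_mx !trmx0 !oppr0 opprK linearN /= trmx1.
Qed.

Lemma Jmx_sqr : J *m J = - 1%:M.
Proof.
rewrite /Jmx mulmx_block !mul0mx !mulmx0 !mul1mx !mulmx1 !add0r !addr0.
by rewrite scalar_mx_block opp_block_mx !oppr0.
Qed.

Lemma symplectic_unit (M : 'M[R]_(n + n)) : symplectic M -> M \in unitmx.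
Proof.
move=> sM; have : (- J *m M^T *m J) *m M = 1%:M.
  by rewrite -!mulmxA (mulmxA M^T) sM mulNmx Jmx_sqr opprK.
by case/mulmx1_unit.
Qed.

(** M^T J M = J exhibits - J M^T J as a left inverse of M, hence also as a
    right inverse. *)
Lemma symplectic_tr (M : 'M[R]_(n + n)) : symplectic M -> M *m J *m M^T = J.
Proof.
move=> sM; have : (- J *m M^T *m J) *m M = 1%:M.
  by rewrite -!mulmxA (mulmxA M^T) sM mulNmx Jmx_sqr opprK.
move/mulmx1C; rewrite mulNmx => /(congr1 (mulmx^~ J)).
rewrite mul1mx => {2}<-; rewrite !(mulmxN, mulNmx) -!mulmxA Jmx_sqr.
by rewrite !(mulmxN, mulNmx) mulmx1 opprK.
Qed.

(** A congruence of A by a symplectic M is a similarity of J A by the same M: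
    this turns statements on quadratic forms into statements on operators. *)
Lemma Hamiltonian_conj (A M E : 'M[R]_(n + n)) :
  symplectic M -> M^T *m A *m M = E -> J *m A *m M = M *m J *m E.
Proof. by move=> sM <-; rewrite !mulmxA symplectic_tr. Qed.

Implicit Types (U V W : {vspace 'cV[R]_(n + n)}).

Lemma symp_formC (x y : 'cV[R]_(n + n)) : inner x (J *m y) = - inner y (J *m x).
Proof. by rewrite inner_mulr tr_Jmx mulNmx innerC innerNr. Qed.

Lemma symp_orthogonalC U V : symp_orthogonal U V -> symp_orthogonal V U.
Proof. by move=> UV u uU v vV; rewrite symp_formC UV ?oppr0. Qed.

Lemma symp_orthogonalD U V W :
  symp_orthogonal U V -> symp_orthogonal U W -> symp_orthogonal U (V + W)%VS.
Proof.
move=> UV UW _ /memv_addP[v vV [w wW ->]] u uU.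
by rewrite innerDl UV ?UW ?addr0.
Qed.

Lemma symp_orthogonal_cap U V :
  symp_subspace U -> symp_orthogonal U V -> (U :&: V = 0)%VS.
Proof.
move=> sU UV; apply/eqP; rewrite -subv0; apply/subvP => w.
rewrite memv_cap => /andP[wU wV]; have : [set 0]%classic w.
  by rewrite -sU; split=> //; apply: UV.
by move=> ->; rewrite mem0v.
Qed.

Lemma block_diag_mx (d d' : 'rV[R]_n) :
  block_mx (diag_mx d) 0 0 (diag_mx d') = diag_mx (row_mx d d').
Proof. by rewrite diag_mx_row. Qed.

(** J exchanges the coordinates i and n + i up to sign, and d is repeated on
    both halves, so J respects any condition on the entries of row_mx d d. *)
Lemma mul_Jmx_support (d : 'rV[R]_n) (s : pred R) (v : 'cV[R]_(n + n)) :
  let e := row_mx d d in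
  (forall j, ~~ s (e 0 j) -> v j 0 = 0) ->
  forall j, ~~ s (e 0 j) -> (J *m v) j 0 = 0.
Proof.
move=> e v0 j; rewrite -[v]vsubmxK mul_block_col !mul0mx add0r addr0 mulNmx !mul1mx.
rewrite /e; case: (split_ordP j) => i ->.
  rewrite row_mxEl col_mxEu mxE => sd; apply: v0.
  by rewrite row_mxEr.
rewrite row_mxEr col_mxEd !mxE => sd; rewrite v0 ?oppr0 //.
by rewrite row_mxEl.
Qed.

End SymplecticMatrices.

(** * The splitting of a diagonalized form *)

Lemma memP_lker (R : realType) m (B : 'M[R]_m) (w : 'cV[R]_m) :
  (w \in lker (mxfun B)) = (B *m w == 0).
Proof. by rewrite memv_ker lfunE. Qed.

(** The span of the columns of M with index in p, when M is invertible,
    encoded as a kernel: membership then reads directly on coordinates. *)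
Definition colspace (R : realType) m (M : 'M[R]_m) (p : pred 'I_m) :
    {vspace 'cV[R]_m} :=
  lker (mxfun (diag_mx (\row_j (~~ p j)%:R) *m invmx M)).

Lemma mem_colspace (R : realType) m (M : 'M[R]_m) p (u : 'cV[R]_m) :
  M \in unitmx ->
  reflect (forall j, ~~ p j -> u j 0 = 0) (M *m u \in colspace M p).
Proof.
move=> uM; rewrite memP_lker -mulmxA mulKmx //.
apply: (iffP eqP) => [/colP u0 j pj | u0].
  by have := u0 j; rewrite mul_diag_mx !mxE pj mul1r.
apply/colP => j; rewrite mul_diag_mx !mxE.
by case: (boolP (p j)) => [_|/u0 ->]; rewrite (mul0r, mulr0).
Qed.

Lemma colspaceP (R : realType) m (M : 'M[R]_m) p (w : 'cV[R]_m) :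
    M \in unitmx -> w \in colspace M p ->
  exists2 u, w = M *m u & forall j, ~~ p j -> u j 0 = 0.
Proof.
move=> uM wp; exists (invmx M *m w); first by rewrite mulKVmx.
by apply/(mem_colspace p _ uM); rewrite mulKVmx.
Qed.

Lemma dim_colspace_le (R : realType) m (M : 'M[R]_m) p :
  M \in unitmx -> (\dim (colspace M p) <= #|p|)%N.
Proof.
move=> uM; rewrite cardE -(size_map (fun j => col j M)).
apply: leq_trans (dim_span _); apply/dimvS/subvP => w.
case/(colspaceP uM) => u -> up.
have -> : M *m u = \sum_(j in p) u j 0 *: col j M.
  rewrite [RHS]big_mkcond /=; apply/colP => i; rewrite mxE summxE.
  apply: eq_bigr => j _; rewrite !unfold_in.
  by case: (boolP (p j)) => [_|/up ->]; rewrite !mxE ?mulr0 // mulrC.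
apply: memv_suml => j pj; apply: memvZ; apply: memv_span.
by apply: map_f; rewrite mem_enum.
Qed.

(** The upper bound by the number of spanning columns holds for p and for its
    complement, and the two spaces together fill R^m, so both are equalities. *)
Lemma dim_colspace (R : realType) m (M : 'M[R]_m) p :
  M \in unitmx -> \dim (colspace M p) = #|p|.
Proof.
move=> uM; apply/eqP; rewrite eqn_leq dim_colspace_le //=.
rewrite -(leq_add2r #|predC p|) cardC card_ord.
have full : (colspace M p + colspace M (predC p))%VS = fullv.
  apply/eqP; rewrite eqEsubv subvf /=; apply/subvP => w _.
  pose u := invmx M *m w; rewrite -(mulKVmx uM w) -/u.
  pose v : 'cV_m := \col_j (if p j then u j 0 else 0).
  have -> : M *m u = M *m v + M *m (u - v) by rewrite -mulmxDr addrC subrK.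
  apply: memv_add; apply/mem_colspace => // j; rewrite !mxE /=.
    by move/negPf ->.
  by rewrite negbK => ->; rewrite subrr.
have : (\dim (colspace M p + colspace M (predC p)) = m)%N.
  by rewrite full dimvf /dim /= muln1.
move=> {1}<-; apply: leq_trans (dimv_add_leqif _ _) _.
by rewrite leq_add2l dim_colspace_le.
Qed.

Section SignSpaces.
Variables (R : realType) (n : nat).
Local Notation J := (Jmx R n).
Variables (A M : 'M[R]_(n + n)) (d : 'rV[R]_n).
Hypotheses (symA : A^T = A) (sM : symplectic M).
Local Notation e := (row_mx d d).
Hypothesis diagA : M^T *m A *m M = diag_mx e.
Let W s := colspace M [pred j | s (e 0 j)].
Let uM : M \in unitmx. Proof. exact: symplectic_unit. Qed.

Lemma symp_form_coord (u v : 'cV[R]_(n + n)) :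
  inner (M *m u) (J *m (M *m v)) = inner u (J *m v).
Proof. by rewrite mulmxA inner_mul mulmxA sM. Qed.

(** If M u is orthogonal to W s, it is orthogonal to - M J u, which lies in W s
    as well; the value of the form there is the square norm of u. *)
Lemma colspace_symplectic s : symp_subspace (W s).
Proof.
apply/seteqP; split=> w /=; last first.
  by move=> ->; split; [exact: mem0v | move=> v _; rewrite /inner trmx0 mul0mx mxE].
case=> /(colspaceP uM)[u -> us] orth; suff -> : u = 0 by rewrite mulmx0.
have JJu : J *m - (J *m u) = u.
  by rewrite mulmxN mulmxA Jmx_sqr mulNmx mul1mx opprK.
apply: inner_eq0; have := orth (M *m - (J *m u)).
rewrite symp_form_coord JJu; apply.
rewrite /= mulmxN memvN; apply/mem_colspace => //.
exact: mul_Jmx_support us.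
Qed.

Lemma colspace_orthogonal (s s' : pred R) : (forall x, s x -> s' x -> false) ->
  symp_orthogonal (W s) (W s').
Proof.
move=> ss' _ /(colspaceP uM)[v -> vs'] _ /(colspaceP uM)[u -> us].
rewrite symp_form_coord innerE big1 // => j _.
case: (boolP (s (e 0 j))) => sj; last first.
  by rewrite (mul_Jmx_support us sj) mulr0.
by rewrite vs' ?mul0r //; apply/negP => sj'; have := ss' _ sj sj'.
Qed.

Lemma colspace_invariant s : mxinvariant (J *m A) (W s).
Proof.
apply/subvP => _ /memv_imgP[_ /(colspaceP uM)[u -> us] ->].
rewrite lfunE /= mulmxA (Hamiltonian_conj sM diagA) -!mulmxA.
apply/mem_colspace => //; apply: mul_Jmx_support => j sj.
by rewrite mul_diag_mx mxE us // mulr0.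
Qed.

(** The factor c covers the positive and the negative case (c = 1 and -1). *)
Lemma colspace_definite c (s : pred R) : (forall x, s x -> 0 < c * x) ->
  posdef_on (c *: A) (W s).
Proof.
move=> sc w /(colspaceP uM)[u -> us] Mu0.
have [i ui] : exists i, u i 0 != 0.
  by apply/cV0Pn; apply: contra_neq Mu0 => ->; rewrite mulmx0.
have si : s (e 0 i) by apply: contraNT ui => /us ->.
have -> : inner (M *m u) (c *: A *m (M *m u)) =
    \sum_j c * e 0 j * u j 0 ^+ 2.
  rewrite mulmxA inner_mul -scalemxAl -scalemxAr mulmxA diagA innerE.
  apply: eq_bigr => j _; rewrite -scalemxAl mul_diag_mx mxE [X in c * X]mxE.
  by rewrite expr2 mulrCA -mulrA; congr (_ * _); rewrite mulrCA.
rewrite (bigD1 i) //=; apply: ltr_wpDr; last first.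
  by rewrite mulr_gt0 ?sc // lt_def sqr_ge0 sqrf_eq0 ui.
apply: sumr_ge0 => j _; case: (boolP (s (e 0 j))) => [/sc/ltW sj|/us ->].
  by rewrite mulr_ge0 ?sqr_ge0.
by rewrite expr0n mulr0.
Qed.

Lemma colspace_kernel : lker (mxfun A) = W (fun x => x == 0).
Proof.
apply/vspaceP => w; rewrite memP_lker -(mulKVmx uM w); set u := invmx M *m w.
have -> : (A *m (M *m u) == 0) = (diag_mx e *m u == 0).
  rewrite -diagA -!mulmxA; apply/eqP/eqP => [->|]; first by rewrite mulmx0.
  move/(congr1 (mulmx (invmx M^T))); rewrite mulKmx ?unitmx_tr //.
  by rewrite mulmx0.
apply/eqP/idP => [eu0 | /(mem_colspace _ _ uM) u0].
  apply/mem_colspace => // j /= ej0; move/colP/(_ j): eu0.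
  rewrite mul_diag_mx mxE [RHS]mxE => /eqP.
  by rewrite mulf_eq0 (negPf ej0) => /eqP.
apply/colP => j; rewrite mul_diag_mx [LHS]mxE [RHS]mxE.
by case: (eqVneq (e 0 j) 0) => [->|/u0 ->]; rewrite (mul0r, mulr0).
Qed.

Lemma splitting_of_diagonal :
  symp_splitting A (W (fun x => x < 0)) (W (fun x => x == 0))
                   (W (fun x => 0 < x)).
Proof.
have [neg zero pos] := sylvester_inertia symA uM diagA.
split.
- by split; apply: colspace_symplectic.
- by split; apply: colspace_orthogonal => x; case: ltgtP.
- by rewrite neg zero pos !dim_colspace.
- by split; apply: colspace_invariant.
split.
- rewrite /negdef_on -scaleN1r; apply: colspace_definite => x x0.
  by rewrite mulN1r oppr_gt0.
- exact: colspace_kernel.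
- by rewrite -[A]scale1r; apply: colspace_definite => x; rewrite mul1r.
Qed.

End SignSpaces.

(** * Spectrum and uniqueness of the diagonal form *)

(** The rows (1, i) and (1, -i) are the eigenvectors of the rotation by J in
    each symplectic plane; up to a factor 2 the inverse is the conjugate
    transpose. *)
Lemma complex_coordinates_unit (C : numClosedFieldType) n :
  block_mx 1%:M 'i%:M 1%:M (- 'i)%:M \in @unitmx C (n + n).
Proof.
have two0 : (2 : C) != 0 by rewrite pnatr_eq0.
suff : block_mx 1%:M 'i%:M 1%:M (- 'i)%:M *m
    ((2^-1 : C) *: block_mx 1%:M 1%:M (- 'i)%:M 'i%:M) = 1%:M :> 'M_(n + n).
  by case/mulmx1_unit.
rewrite -scalemxAr mulmx_block !mul1mx -!scalar_mxM mulrN mulNr -expr2 sqrCi.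
rewrite !mulrN -expr2 sqrCi opprK -!raddfD /= subrr -[1 + 1]/2 raddf0.
rewrite mulNr -expr2 sqrCi opprK scale_block_mx !scaler0 !scale_scalar_mx.
by rewrite mulVf // -scalar_mx_block.
Qed.

(** i J A is similar to i J E with E = diag(d, d), and the coordinates x + i y,
    x - i y diagonalize the latter into diag(d, - d). *)
Lemma symp_diagonal_spectrum (R : realType) n (A M : 'M[R]_(n + n))
    (d : 'rV[R]_n) :
  symp_diagonalizes A M d ->
  eigenvalues_are (iJmx A)
    ([seq (d 0 i)%:C%C | i <- enum 'I_n] ++
     [seq (- d 0 i)%:C%C | i <- enum 'I_n]).
Proof.
case=> sM AE; have uM := symplectic_unit sM.
pose D := cx R (diag_mx d).
pose T : 'M[R[i]]_(n + n) := block_mx 1%:M 'i%:M 1%:M (- 'i)%:M.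
have uT : T \in unitmx := complex_coordinates_unit R[i] n.
have TE : T *m ('i *: cx R (Jmx R n *m block_mx (diag_mx d) 0 0 (diag_mx d)))
    = block_mx D 0 0 (- D) *m T.
  rewrite /Jmx mulmx_block !(mul0mx, mulmx0, mul1mx, mulNmx, add0r, addr0).
  rewrite map_block_mx !map_mxN !map_mx0 -/D scale_block_mx !scaler0.
  rewrite !mulmx_block !(mul0mx, mulmx0, mul1mx, mulmx1, add0r, addr0).
  rewrite !mul_mx_scalar !mul_scalar_mx !scalerN !scalerA -expr2 sqrCi.
  by rewrite mulNr -expr2 sqrCi !scaleNr scale1r !opprK.
pose P := T *m cx R (invmx M).
have uP : P \in unitmx by rewrite unitmx_mul uT map_unitmx unitmx_inv.
have PE : P *m iJmx A = block_mx D 0 0 (- D) *m P.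
  rewrite /iJmx -[complex.Complex 0 1]/('i) [RHS]mulmxA -TE.
  rewrite -!scalemxAr -scalemxAl /P -!mulmxA -!map_mxM.
  congr ('i *: (T *m cx R _)).
  apply: (can_inj (mulKmx uM)); rewrite mulKVmx //.
  by rewrite !mulmxA -(Hamiltonian_conj sM AE) mulmxK.
rewrite /eigenvalues_are (char_poly_similar uP PE).
have -> : block_mx D 0 0 (- D) = diag_mx (row_mx (cx R d) (- cx R d)).
  by rewrite diag_mx_row linearN /D map_diag_mx.
rewrite char_poly_trig ?diag_mx_is_trig // big_split_ord big_cat /=.
congr (_ * _); rewrite big_map big_enum /=; apply: eq_bigr => i _.
  by rewrite mxE eqxx mulr1n row_mxEl mxE.
by rewrite mxE eqxx mulr1n row_mxEr !mxE (rmorphN (real_complex R)).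
Qed.

(** N changes one diagonalizing basis into the other.  It intertwines J E with
    J E', hence also their squares - E^2 and - E'^2; between diagonal matrices
    this only says that N has no entry linking different squares. *)
Lemma square_intertwine (R : realType) n (A M M' : 'M[R]_(n + n))
    (d d' : 'rV[R]_n) (N := invmx M *m M') (e := row_mx d d) (e' := row_mx d' d') :
    symp_diagonalizes A M d -> symp_diagonalizes A M' d' ->
  [/\ N \in unitmx, N^T *m diag_mx e *m N = diag_mx e'
    & forall i j, N i j != 0 -> e 0 i ^+ 2 = e' 0 j ^+ 2].
Proof.
case=> sM AE [sM' AE']; rewrite !block_diag_mx -/e -/e' in AE AE'.
have uM := symplectic_unit sM; have uM' := symplectic_unit sM'.
have M'E : M' = M *m N by rewrite mulKVmx.
have uN : N \in unitmx by rewrite unitmx_mul unitmx_inv uM.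
clearbody N; split=> //; first by rewrite -AE -AE' M'E trmx_mul !mulmxA.
pose K := Jmx R n.
have KE : K *m diag_mx e *m N = N *m (K *m diag_mx e').
  apply: (can_inj (mulKmx uM)).
  rewrite [RHS]mulmxA -M'E [RHS]mulmxA -(Hamiltonian_conj sM' AE').
  rewrite [LHS]mulmxA [M *m (_ *m _)]mulmxA -(Hamiltonian_conj sM AE).
  by rewrite -(mulmxA _ M N) -M'E.
have sqK (f : 'rV[R]_n) (E := diag_mx (row_mx f f)) : K *m E *m (K *m E) = - (E *m E).
  have -> : K *m E *m (K *m E) = K *m K *m E *m E.
    rewrite -!mulmxA; congr (_ *m _); rewrite !mulmxA; congr (_ *m _).
    rewrite /E /K /Jmx -block_diag_mx !mulmx_block.
    by rewrite !(mul0mx, mulmx0, add0r, addr0, mulmx1, mul1mx, mulmxN, mulNmx).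
  by rewrite Jmx_sqr !mulNmx mul1mx.
have sqE : diag_mx e *m diag_mx e *m N = N *m (diag_mx e' *m diag_mx e').
  have : K *m diag_mx e *m (K *m diag_mx e) *m N =
      N *m (K *m diag_mx e' *m (K *m diag_mx e')).
    by rewrite -[LHS]mulmxA KE [LHS]mulmxA KE -!mulmxA.
  by rewrite !sqK mulNmx mulmxN => /oppr_inj.
move=> i j Nij; move/matrixP/(_ i j): sqE.
have -> : (diag_mx e *m diag_mx e *m N) i j = N i j * e 0 i ^+ 2.
  by rewrite -mulmxA mul_diag_mx mxE mul_diag_mx mxE mulrA mulrC.
have -> : (N *m (diag_mx e' *m diag_mx e')) i j = N i j * e' 0 j ^+ 2.
  by rewrite mulmxA mul_mx_diag mxE mul_mx_diag mxE -mulrA.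
by move/(mulfI Nij).
Qed.

Lemma count_undouble (R : realType) n (d d' : 'rV[R]_n) (s : pred R) :
    #|[pred j | s (row_mx d d 0 j)]| = #|[pred j | s (row_mx d' d' 0 j)]| ->
  #|[pred i | s (d 0 i)]| = #|[pred i | s (d' 0 i)]|.
Proof.
have dbl (f : 'rV[R]_n) : #|[pred j | s (row_mx f f 0 j)]|
    = (#|[pred i | s (f 0 i)]|).*2.
  rewrite -!sum1_card big_mkcond big_split_ord /= -addnn [in RHS]big_mkcond.
  by congr addn; apply: eq_bigr => i _; rewrite !inE (row_mxEl, row_mxEr).
by rewrite !dbl => /double_inj.
Qed.

(** For c = 0 the inertia of E suffices.  For c <> 0, N commutes with the
    cut-off to the entries of square c^2, so it is also a congruence between
    the truncated forms.  Multiplied by c, these have entries c^2 where d = c,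
    - c^2 where d = - c and 0 elsewhere, so their positive index is twice the
    multiplicity of c. *)
Lemma symp_diagonal_multiplicity (R : realType) n (A M M' : 'M[R]_(n + n))
    (d d' : 'rV[R]_n) :
    symp_diagonalizes A M d -> symp_diagonalizes A M' d' ->
  forall c, #|[pred i | d 0 i == c]| = #|[pred i | d' 0 i == c]|.
Proof.
move=> dA dA' c; apply: (count_undouble (s := fun x => x == c)).
have [uN NE Nsq] := square_intertwine dA dA'.
set N := invmx M *m M' in uN NE Nsq.
set e := row_mx d d in NE Nsq *; set e' := row_mx d' d' in NE Nsq *.
case: (eqVneq c 0) => [->|c0].
  have symE : (diag_mx e)^T = diag_mx e by rewrite tr_diag_mx.
  have [_ <- _] := inertia_diag e.
  by have [_ <- _] := sylvester_inertia symE uN NE.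
pose F (f : 'rV[R]_(n + n)) : 'rV[R]_(n + n) :=
  \row_j (if f 0 j ^+ 2 == c ^+ 2 then c * f 0 j else 0).
have NF : N^T *m diag_mx (F e) *m N = diag_mx (F e').
  pose G (f : 'rV[R]_(n + n)) : 'rV[R]_(n + n) :=
    \row_j (if f 0 j ^+ 2 == c ^+ 2 then c else 0).
  have GE f j : G f 0 j = if f 0 j ^+ 2 == c ^+ 2 then c else 0 by rewrite mxE.
  have FE f : diag_mx (F f) = diag_mx f *m diag_mx (G f).
    rewrite mulmx_diag; congr diag_mx; apply/rowP => j; rewrite !mxE.
    by case: ifP => _; rewrite ?mulr0 // mulrC.
  have GN : diag_mx (G e) *m N = N *m diag_mx (G e').
    apply/matrixP => i j; rewrite mul_diag_mx mul_mx_diag mxE [RHS]mxE.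
    have [->|/Nsq eij] := eqVneq (N i j) 0; first by rewrite mulr0 mul0r.
    by rewrite mulrC !GE eij.
  by rewrite !FE -!mulmxA GN -NE !mulmxA.
have posF f : #|[pred j | (0 < F f 0 j)%R]| = #|[pred j | f 0 j == c]|.
  apply: eq_card => j; rewrite !inE mxE.
  rewrite eqf_sqr; case: (eqVneq (f 0 j) c) => [->|_] /=.
    by rewrite -expr2 lt_def sqr_ge0 sqrf_eq0 c0.
  case: eqP => [->|_]; last by rewrite ltxx.
  by rewrite mulrN -expr2 oppr_gt0 ltNge sqr_ge0.
rewrite -!posF; have symF : (diag_mx (F e))^T = diag_mx (F e) by rewrite tr_diag_mx.
have [_ _ <-] := inertia_diag (F e).
by have [_ _ <-] := sylvester_inertia symF uN NF.
Qed.

Lemma symp_diagonal_unique (R : realType) n (A M M' : 'M[R]_(n + n))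
    (d d' : 'rV[R]_n) :
    symp_diagonalizes A M d -> symp_diagonalizes A M' d' ->
  exists s : 'S_n, d' = col_perm s d.
Proof.
move=> dA dA'; have dd' := symp_diagonal_multiplicity dA dA'.
pose t (f : 'rV[R]_n) := [tuple f 0 i | i < n].
have /tuple_permP[s sE] : perm_eq (t d') (t d).
  have cE (f : 'rV[R]_n) c : count_mem c (t f) = #|[pred i | f 0 i == c]|.
    rewrite -sum1_count big_tuple -sum1_card.
    by apply: eq_bigl => i; rewrite tnth_mktuple inE.
  by apply/allP => c _ /=; rewrite !cE dd'.
exists s; apply/rowP => i; rewrite mxE.
have := congr1 (fun r => nth 0 r i) sE.
by rewrite -!tnth_nth !tnth_mktuple.
Qed.

(** * Diagonal form of a tamed matrix *)

Lemma conjCmxM (C : numClosedFieldType) m n p (P : 'M[C]_(m, n)) (Q : 'M[C]_(n, p)) :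
  map_mx Num.conj (P *m Q) = map_mx Num.conj P *m map_mx Num.conj Q.
Proof. exact: map_mxM. Qed.

Section SymplecticEigenrows.
Variables (C : numClosedFieldType) (m : nat) (J A S : 'M[C]_m).
Hypotheses (trJ : J^T = - J) (JJ : J *m J = - 1%:M).
Hypotheses (trA : A^T = A) (trS : S^T = S).
Hypotheses (cJ : map_mx Num.conj J = J) (cA : map_mx Num.conj A = A)
  (cS : map_mx Num.conj S = S).
Hypothesis posS : forall z : 'rV[C]_m, z != 0 -> 0 < (z *m S *m z ^t*) 0 0.
Hypothesis commAS : A *m J *m S = S *m J *m A.

(** The skew-orthogonal complement of a row space stable under B J is stable
    under B J, because B is self-adjoint and J skew. *)
Lemma skew_complement_stable k (B : 'M[C]_m) (Y : 'M[C]_(k, m)) (D : 'M[C]_k) :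
  B^T = B -> Y *m B *m J = D *m Y -> stablemx (kermx (J *m Y^T)) (B *m J).
Proof.
move=> trB YB; have YBE : B *m Y^T = J *m Y^T *m D^T.
  have YB' : Y *m B = - (D *m (Y *m J)).
    apply: oppr_inj; rewrite opprK mulmxA -YB -mulmxA JJ.
    by rewrite mulmxN mulmx1.
  move/(congr1 trmx): YB'; rewrite linearN /= !trmx_mul trB trJ => ->.
  by rewrite mulNmx mulNmx opprK.
apply/sub_kermxP; have := mulmx_ker (J *m Y^T); move: (kermx _) => V VY.
rewrite -!mulmxA (mulmxA J J) JJ mulNmx mul1mx !mulmxN.
by rewrite YBE mulmxA VY mul0mx oppr0.
Qed.

Lemma common_eigenrow (V F G : 'M[C]_m) :
    V != 0 -> stablemx V F -> stablemx V G -> F *m G = G *m F ->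
  exists (z : 'rV[C]_m) (a b : C),
    [/\ (z <= V)%MS, z != 0, z *m F = a *: z & z *m G = b *: z].
Proof.
move=> V0 VF VG FG.
have rV : (0 < \rank V)%N by rewrite lt0n mxrank_eq0.
have [|v v0 /and3P[vF vG _]] :=
    @common_eigenvector _ _ [:: restrictmx V F; restrictmx V G] rV.
  have FGV : restrictmx V F *m restrictmx V G = restrictmx V G *m restrictmx V F.
    by rewrite -!conjmxM ?inE ?stablemx_row_base // FG.
  by move=> B D; rewrite !inE => /orP[] /eqP-> /orP[] /eqP->.
move: vF vG; rewrite /= !stablemx_restrict // => /sub_rVP[a aE] /sub_rVP[b bE].
exists (v *m row_base V), a, b; split=> //.
  by rewrite (submx_trans (submxMl _ _)) ?eq_row_base.
by rewrite mulmx_free_eq0 ?row_base_free.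
Qed.

(** A real skew matrix B makes z B z^* purely imaginary, and replacing z by its
    conjugate changes the sign. *)
Lemma skew_form_conj (B : 'M[C]_m) (z : 'rV[C]_m) : B^T = - B ->
  map_mx Num.conj B = B ->
  ((map_mx Num.conj z *m B *m (map_mx Num.conj z) ^t*) 0 0
    = - (z *m B *m z ^t*) 0 0) *
  (((z *m B *m z ^t*) 0 0)^* = - (z *m B *m z ^t*) 0 0).
Proof.
move=> trB cB; set q := z *m B *m z ^t*.
have q1 : map_mx Num.conj z *m B *m (map_mx Num.conj z) ^t* = q ^ Num.conj.
  by rewrite /q !map_mxM cB map_trmx.
have q2 : q ^t* = - q.
  by rewrite /q !trmx_mul !map_mxM trmxCK trB map_mxN cB mulNmx mulmxN mulmxA.
have q3 : (q 0 0)^* = - q 0 0.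
  by have /matrixP/(_ 0 0) := q2; rewrite !mxE.
by split=> //; rewrite q1 mxE.
Qed.

(** A common eigenvector v of A J and S J satisfies v S = - b v J, so that
    v S v^* > 0 forces the imaginary number v J v^* to be nonzero.  Conjugating
    v if needed fixes its sign, and scaling fixes its modulus. *)
Lemma symplectic_eigenrow (V : 'M[C]_m) :
    V != 0 -> stablemx V (A *m J) -> stablemx V (S *m J) ->
    (forall v : 'rV[C]_m, (v <= V)%MS -> (map_mx Num.conj v <= V)%MS) ->
  exists (z : 'rV[C]_m) (a b : C),
    [/\ (z <= V)%MS, z *m A *m J = a *: z, z *m S *m J = b *: z
      & (z *m J *m z ^t*) 0 0 = - (2 * 'i)].
Proof.
move=> V0 VA VS Vconj; have [|v [a [b [vV v0 va vb]]]] := common_eigenrow V0 VA VS.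
  by rewrite !mulmxA commAS.
rewrite !mulmxA in va vb.
pose q := (v *m J *m v ^t*) 0 0; have [qc qI] := skew_form_conj v trJ cJ.
rewrite -/q in qc qI.
have q0 : q != 0.
  have vS : v *m S = - (b *: (v *m J)).
    by rewrite scalemxAl -vb -!mulmxA JJ !mulmxN mulmx1 opprK.
  apply/negP => /eqP q0; have := posS v0.
  by rewrite vS mulNmx -scalemxAl mxE [X in - X]mxE -/q q0 mulr0 oppr0 ltxx.
pose r := - (q * 'i).
have rreal : r \is Num.real.
  by apply/CrealP; rewrite /r rmorphN rmorphM /= qI conjCi mulrNN.
have qE : q = 'i * r by rewrite /r mulrN mulrCA -expr2 sqrCi mulrN1 opprK.
have r0 : r != 0 by apply: contra_neq q0 => r0; rewrite qE r0 mulr0.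
suff [w [a' [b' [wV wa wb wq]]]] : exists (w : 'rV[C]_m) (a' b' : C),
    [/\ (w <= V)%MS, w *m A *m J = a' *: w, w *m S *m J = b' *: w
      & (w *m J *m w ^t*) 0 0 = - 'i * `|r|].
  (* Scaling by c multiplies the form by c^2 = 2 / |r|. *)
  pose c := sqrtC (2 / `|r|).
  have c0 : 0 <= c by rewrite sqrtC_ge0 divr_ge0.
  exists (c *: w), a', b'; split; first exact: scalemx_sub.
  - by rewrite -!scalemxAl wa scalerA mulrC -scalerA.
  - by rewrite -!scalemxAl wb scalerA mulrC -scalerA.
  rewrite linearZ /= map_mxZ -!scalemxAl -scalemxAr scalerA mxE wq.
  rewrite /= conj_Creal ?ger0_real // -expr2 sqrtCK.
  by rewrite mulrCA divfK ?normr_eq0 // mulNr mulrC.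
case: (real_ge0P rreal) => r_sign; last first.
  by exists v, a, b; split=> //; rewrite mulNr mulrN opprK -qE.
exists (map_mx Num.conj v), a^*, b^*; split; first exact: Vconj.
- by rewrite -{1}cA -{1}cJ -!map_mxM va map_mxZ.
- by rewrite -{1}cS -{1}cJ -!map_mxM vb map_mxZ.
by rewrite qc qE mulNr.
Qed.

(** Induction on k: the next row is found in the complement of the rows already
    chosen and of their conjugates, which has dimension at least m - 2k and is
    stable under A J, S J and conjugation.  The value - 2i makes the real and
    imaginary parts of Z a symplectic basis without rescaling. *)
Lemma symplectic_eigenrows k : (k + k <= m)%N ->
  exists (Z : 'M[C]_(k, m)) (a b : 'rV[C]_k),
    [/\ Z *m A *m J = diag_mx a *m Z, Z *m S *m J = diag_mx b *m Z,
        Z *m J *m Z^T = 0 & Z *m J *m Z ^t* = (- (2 * 'i))%:M].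
Proof.
elim: k => [_|k IH km].
  by exists 0, 0, 0; split; apply/matrixP => - [].
have [|Z [a [b [Za Zb ZZ ZZc]]]] := IH.
  by apply: leq_trans km; rewrite addSn addnS ltnW.
pose Y := col_mx Z (map_mx Num.conj Z).
have YE (B : 'M[C]_m) (c : 'rV[C]_k) : map_mx Num.conj B = B ->
    Z *m B *m J = diag_mx c *m Z ->
    Y *m B *m J = diag_mx (row_mx c (map_mx Num.conj c)) *m Y.
  move=> cB ZB; rewrite !mul_col_mx ZB -{1}cB -{1}cJ -!conjCmxM ZB conjCmxM.
  by rewrite map_diag_mx diag_mx_row mul_block_col !mul0mx addr0 add0r.
pose V := kermx (J *m Y^T).
have V0 : V != 0.
  rewrite -mxrank_eq0 mxrank_ker subn_eq0 -ltnNge.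
  apply: leq_ltn_trans (rank_leq_col _) _.
  by apply: leq_trans km; rewrite addSn addnS ltnW.
have VP (v : 'rV[C]_m) : reflect (v *m J *m Z^T = 0 /\ v *m J *m Z ^t* = 0) (v <= V)%MS.
  apply: (iffP sub_kermxP); rewrite mulmxA tr_col_mx mul_mx_row -map_trmx -row_mx0.
    by case/eq_row_mx.
  by case=> -> ->.
have Vconj (v : 'rV[C]_m) : (v <= V)%MS -> (map_mx Num.conj v <= V)%MS.
  case/VP => v1 v2; apply/VP; rewrite -{1 2}cJ -!conjCmxM; split.
    by rewrite -[Z^T]map_mxCK -conjCmxM v2 map_mx0.
  by rewrite v1 map_mx0.
have [z [a0 [b0 [/VP[zZ zZc] za zb zz]]]] :=
  symplectic_eigenrow V0 (skew_complement_stable trA (YE A a cA Za))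
    (skew_complement_stable trS (YE S b cS Zb)) Vconj.
(* A block decomposition needs the dimension to be literally a sum. *)
rewrite -[k.+1]/(1 + k)%N.
exists (col_mx z Z), (row_mx a0%:M a), (row_mx b0%:M b).
have dE (c0 : C) (c : 'rV[C]_k) :
  diag_mx (row_mx c0%:M c : 'rV[C]_(1 + k)) = block_mx c0%:M 0 0 (diag_mx c).
  rewrite diag_mx_row; congr (block_mx _ _ _ _).
  by apply/matrixP => i j; rewrite !ord1 !mxE.
split.
- rewrite dE !mul_col_mx !mul_row_col !mul0mx addr0 add0r za Za.
  by rewrite mul_scalar_mx.
- rewrite dE !mul_col_mx !mul_row_col !mul0mx addr0 add0r zb Zb.
  by rewrite mul_scalar_mx.
- rewrite !mul_col_mx tr_col_mx !mul_mx_row ZZ zZ.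
  have -> : Z *m J *m z^T = 0.
    apply: trmx_inj; rewrite trmx0 !trmx_mul trmxK trJ mulNmx mulmxN.
    by rewrite mulmxA zZ oppr0.
  have -> : z *m J *m z^T = 0.
    apply/matrixP => i j; rewrite !ord1 mxE.
    set q := z *m J *m z^T; have qN : q^T = - q.
      by rewrite /q !trmx_mul trmxK trJ mulNmx mulmxN mulmxA.
    have /matrixP/(_ 0 0)/eqP := qN; rewrite !mxE -addr_eq0 -mulr2n.
    by rewrite mulrn_eq0 => /eqP.
  by rewrite !row_mx0 col_mx0.
rewrite !mul_col_mx tr_col_mx map_row_mx !mul_mx_row ZZc zZc.
have -> : Z *m J *m z ^t* = 0.
  apply: (can_inj (@trmxCK C _ _)); rewrite trmx0 map_mx0.
  rewrite !trmx_mul !conjCmxM trmxCK trJ map_mxN cJ mulNmx mulmxN.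
  by rewrite mulmxA zZc oppr0.
rewrite [RHS]scalar_mx_block; congr (block_mx _ _ _ _).
by apply/matrixP => i j; rewrite !ord1 zz mxE.
Qed.

End SymplecticEigenrows.

Section RealParts.
Variable R : realType.

Lemma cx_rectE m n (Z : 'M[R[i]]_(m, n)) :
  Z = cx R (map_mx (@complex.Re R) Z) + 'i *: cx R (map_mx (@complex.Im R) Z).
Proof. by apply/matrixP => i j; rewrite !mxE; apply: complexE. Qed.

Lemma cx_rect_inj m n (P Q P' Q' : 'M[R]_(m, n)) :
  cx R P + 'i *: cx R Q = cx R P' + 'i *: cx R Q' -> P = P' /\ Q = Q'.
Proof.
move=> /matrixP PQ; have PQ' i j : (Complex (P i j) (Q i j)) = Complex (P' i j) (Q' i j).
  by rewrite [LHS]complexE [RHS]complexE /=; have := PQ i j; rewrite !mxE.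
by split; apply/matrixP => i j; case: (PQ' i j).
Qed.

Section Expansion.
Variables (k m : nat) (X Y : 'M[R]_(k, m)) (B : 'M[R]_m).
Let Z := cx R X + 'i *: cx R Y.

Lemma cx_rect_form :
  Z *m cx R B *m Z^T = cx R (X *m B *m X^T - Y *m B *m Y^T)
    + 'i *: cx R (X *m B *m Y^T + Y *m B *m X^T).
Proof.
have -> : Z^T = cx R X^T + 'i *: cx R Y^T.
  by rewrite /Z linearD linearZ /= !map_trmx.
rewrite /Z !(mulmxDl, mulmxDr) -!scalemxAl -!scalemxAr.
rewrite scalerA -expr2 sqrCi scaleN1r -!map_mxM map_mxB map_mxD /=.
by rewrite scalerDr [X in _ + X = _]addrC addrACA [X in _ + X = _]addrC.
Qed.

Lemma cx_rect_herm :
  Z *m cx R B *m Z ^t* = cx R (X *m B *m X^T + Y *m B *m Y^T)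
    + 'i *: cx R (Y *m B *m X^T - X *m B *m Y^T).
Proof.
have -> : Z ^t* = cx R X^T - 'i *: cx R Y^T.
  rewrite /Z linearD linearZ /= map_mxD map_mxZ /= conjCi -!map_trmx.
  by rewrite !conj_cx scaleNr.
rewrite /Z !(mulmxDl, mulmxBr) -!scalemxAl -!scalemxAr.
rewrite scalerA -expr2 sqrCi scaleN1r -!map_mxM map_mxB map_mxD.
by rewrite /= scalerBr opprB addrACA.
Qed.

End Expansion.

(** Writing Z = X + i Y, the relations on Z J Z^T and Z J Z^* say that the rows
    of X and Y form a symplectic basis.  Since Z A = - diag(a) Z J, the same
    products with A in the middle are 0 and a diagonal matrix; comparing real and
    imaginary parts gives X A X^T = Y A Y^T = diag(e) / 2 and X A Y^T = 0. *)
Lemma diagonalizable_of_taming n (A S : 'M[R]_(n + n)) :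
    A^T = A -> S^T = S ->
    (forall x : 'rV[R]_(n + n), x != 0 -> 0 < (x *m S *m x^T) 0 0) ->
    A *m Jmx R n *m S = S *m Jmx R n *m A ->
  exists M d, symp_diagonalizes A M d.
Proof.
move=> symA symS posS comm; pose J := Jmx R n.
have trcx (B : 'M[R]_(n + n)) : (cx R B)^T = cx R B^T by rewrite map_trmx.
have posSC (z : 'rV[R[i]]_(n + n)) : z != 0 -> 0 < (z *m cx R S *m z ^t*) 0 0.
  rewrite (cx_rectE z) cx_rect_herm; set x := map_mx _ z; set y := map_mx _ z.
  move=> z0.
  have -> : y *m S *m x^T - x *m S *m y^T = 0.
    have -> : y *m S *m x^T = (x *m S *m y^T)^T.
      by rewrite !trmx_mul trmxK symS mulmxA.
    by apply/matrixP => i j; rewrite !ord1 !mxE subrr.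
  rewrite map_mx0 scaler0 addr0 mxE ltcR mxE.
  have ge0 (u : 'rV[R]_(n + n)) : 0 <= (u *m S *m u^T) 0 0.
    by have [->|/posS/ltW //] := eqVneq u 0; rewrite mul0mx mul0mx mxE.
  have [x0|/posS x0] := eqVneq x 0; last by rewrite ltr_wpDr.
  rewrite ltr_wpDl // posS //; apply: contra_neq z0 => y0.
  by rewrite x0 y0 !map_mx0 scaler0 addr0.
have [||||||||Z [a [b [Za _ ZZ ZZc]]]] :=
    @symplectic_eigenrows _ _ (cx R J) (cx R A) (cx R S)
      _ _ _ _ _ _ _ posSC _ n (leqnn _).
- by rewrite trcx tr_Jmx map_mxN.
- by rewrite -map_mxM Jmx_sqr map_mxN map_mx1.
- by rewrite trcx symA.
- by rewrite trcx symS.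
- exact: conj_cx.
- exact: conj_cx.
- exact: conj_cx.
- by rewrite -!map_mxM comm.
move: Za ZZ ZZc; rewrite (cx_rectE Z).
set X := map_mx _ Z; set Y := map_mx _ Z; set Z' := cx R X + _ => Za ZZ ZZc.
have ZA : Z' *m cx R A = - (diag_mx a *m (Z' *m cx R J)).
  apply: oppr_inj; rewrite opprK mulmxA -Za -mulmxA -map_mxM Jmx_sqr.
  by rewrite map_mxN map_mx1 mulmxN mulmx1.
have AZ : Z' *m cx R A *m Z'^T = 0.
  by rewrite ZA mulNmx -mulmxA ZZ mulmx0 oppr0.
have AZc : Z' *m cx R A *m Z' ^t* = diag_mx ((2 * 'i) *: a).
  rewrite ZA mulNmx -mulmxA ZZc raddfN /= mulmxN opprK mul_mx_scalar.
  by rewrite linearZ.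
have czero : (0 : 'M[R[i]]_n) = cx R 0 + 'i *: cx R 0.
  by rewrite !map_mx0 scaler0 addr0.
move: ZZ ZZc AZ AZc.
rewrite !cx_rect_form !cx_rect_herm czero => /cx_rect_inj[J1 J2].
have -> : (- (2 * 'i))%:M = cx R 0 + 'i *: cx R ((- 2)%:M) :> 'M[R[i]]_n.
  rewrite map_mx0 add0r map_scalar_mx /= (rmorphN (real_complex R)).
  rewrite (rmorph_nat (real_complex R)) scale_scalar_mx.
  by rewrite mulrN mulrC.
move=> /cx_rect_inj[J3 J4] /cx_rect_inj[A1 A2].
rewrite (cx_rectE (_ *: a)) linearD linearZ /= -!map_diag_mx => /cx_rect_inj[].
set e := map_mx _ _; set f := map_mx _ _ => A3 A4.
have half m p (P : 'M[R]_(m, p)) : P + P = 0 -> P = 0.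
  by move/eqP; rewrite -mulr2n -scaler_nat scaler_eq0 pnatr_eq0 => /eqP.
have dbl m p (P Q : 'M[R]_(m, p)) : P + P = Q + Q -> P = Q.
  move=> PQ; apply/eqP; rewrite -subr_eq0; apply/eqP/half.
  by rewrite addrACA -opprD PQ subrr.
have XJX : X *m J *m X^T = 0 /\ Y *m J *m Y^T = 0.
  have E : X *m J *m X^T = Y *m J *m Y^T by apply/eqP; rewrite -subr_eq0 J1.
  by rewrite E in J3 *; have := half _ _ _ J3.
have XJY : X *m J *m Y^T = 1%:M /\ Y *m J *m X^T = - 1%:M.
  have E : Y *m J *m X^T = - (X *m J *m Y^T).
    by apply/eqP; rewrite -addr_eq0 addrC J2.
  rewrite E in J4 *; have -> : X *m J *m Y^T = 1%:M; last by [].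
  by apply: dbl; apply: oppr_inj; rewrite opprD J4 -raddfD -raddfN.
have XAX : X *m A *m X^T = Y *m A *m Y^T by apply/eqP; rewrite -subr_eq0 A1.
have XAYtr : (X *m A *m Y^T)^T = Y *m A *m X^T.
  by rewrite !trmx_mul trmxK symA mulmxA.
have YAX : Y *m A *m X^T = - (X *m A *m Y^T).
  by apply/eqP; rewrite -addr_eq0 addrC A2.
(* X A Y^T is skew, while twice it is, up to sign, a diagonal matrix. *)
have XAY : X *m A *m Y^T = 0.
  rewrite YAX in XAYtr A4; move: (X *m A *m Y^T) XAYtr A4 => P Ptr Pf.
  have fP : - P - P = P + P.
    by rewrite Pf -tr_diag_mx -Pf linearB linearN /= Ptr opprK.
  apply: (half _ _ P); apply: (half _ _ (P + P)).
  by rewrite -{1}fP -opprD addNr.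
exists (col_mx X Y)^T, (2^-1 *: e); split.
  rewrite /symplectic trmxK tr_col_mx mul_col_mx mul_col_row.
  by case: XJX => -> ->; case: XJY => -> ->.
have XAXe : X *m A *m X^T = diag_mx (2^-1 *: e).
  apply: dbl; rewrite {2}XAX A3 -raddfD -scalerDl /=.
  by rewrite -[2^-1]mul1r -splitr scale1r.
rewrite trmxK tr_col_mx mul_col_mx mul_col_row YAX XAY oppr0.
by rewrite -XAX XAXe.
Qed.

End RealParts.

(** * Taming a splitting *)

Lemma linear_mxP (R : realType) m (f : 'End('cV[R]_m)) :
  exists P : 'M[R]_m, forall x, f x = P *m x.
Proof.
exists (\matrix_(i, j) f (delta_mx j 0) i 0) => x.
rewrite {1}[x]matrix_sum_delta linear_sum; apply/colP => i.
rewrite summxE mxE; apply: eq_bigr => j _.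
by rewrite big_ord1 linearZ !mxE mulrC.
Qed.

Section Taming.
Variables (R : realType) (n : nat) (A : 'M[R]_(n + n)).
Hypothesis symA : A^T = A.
Local Notation J := (Jmx R n).
Implicit Types (U V W : {vspace 'cV[R]_(n + n)}).

(** The projection on W along V commutes with J A because both subspaces are
    invariant, and is self-adjoint for the symplectic form because they are
    orthogonal for it. *)
Lemma symp_projection W V :
    symp_subspace W -> symp_orthogonal W V -> (W + V)%VS = fullv ->
    mxinvariant (J *m A) W -> mxinvariant (J *m A) V ->
  exists P : 'M[R]_(n + n),
    [/\ forall x, P *m x \in W, {in W, forall w, P *m w = w},
        {in V, forall v, P *m v = 0}, P *m (J *m A) = J *m A *m P
      & P^T *m J = J *m P].
Proof.
move=> sW WV full invW invV; have WV0 := symp_orthogonal_cap sW WV.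
have [P PE] := linear_mxP (daddv_pi W V).
have PW x : P *m x \in W by rewrite -PE memv_pi.
have Pid : {in W, forall w, P *m w = w}.
  by move=> w wW; rewrite -PE daddv_pi_id.
have dec x : exists v, v \in V /\ x = P *m x + v.
  exists (daddv_pi V W x); split; first exact: memv_pi.
  by rewrite -PE daddv_pi_add // full memvf.
have P0 : {in V, forall v, P *m v = 0}.
  move=> v vV; rewrite -PE; apply: (addIr (daddv_pi V W v)).
  by rewrite daddv_pi_add ?full ?memvf // add0r daddv_pi_id // capvC.
have inv U u : mxinvariant (J *m A) U -> u \in U -> J *m A *m u \in U.
  by move/subvP=> invU uU; apply: invU; rewrite -[_ *m u](lfunE (mulmx _)) memv_img.
exists P; split=> //.
  apply: inner_inj => x y; have [v [vV yE]] := dec y.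
  rewrite -[in LHS]mulmxA -[in RHS](mulmxA (J *m A)) {1}yE mulmxDr mulmxDr.
  by rewrite (Pid _ (inv _ _ invW (PW y))) (P0 _ (inv _ _ invV vV)) addr0.
apply: inner_inj => x y.
have [v [vV yE]] := dec y; have [u [uV xE]] := dec x.
rewrite -!mulmxA [LHS]inner_mulr trmxK {1}yE mulmxDr innerDr.
rewrite [inner _ (J *m v)]symp_formC (WV v vV _ (PW x)) oppr0 addr0.
by rewrite [in RHS]xE innerDl (WV u uV _ (PW y)) addr0.
Qed.

(** S is A with the sign changed on W- and with an arbitrary positive form on
    W0: the term P0^T P0 is seen by A only through A P0 = 0, so it does not
    disturb the commutation. *)
Lemma taming_of_splitting Wm W0 Wp :
  symp_splitting A Wm W0 Wp ->
  exists S : 'M[R]_(n + n),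
    [/\ S^T = S, forall x : 'rV[R]_(n + n), x != 0 -> 0 < (x *m S *m x^T) 0 0
      & A *m J *m S = S *m J *m A].
Proof.
case=> [[sm s0 sp] [om0 omp o0p] [dm d0 dp] [im i0 ip] [neg ker pos]].
have o0m := symp_orthogonalC om0; have opm := symp_orthogonalC omp.
have op0 := symp_orthogonalC o0p.
have om := symp_orthogonalD om0 omp; have o0 := symp_orthogonalD o0m o0p.
have op := symp_orthogonalD opm op0.
(* The dimensions are nu, xi and pi of A, and these add up to 2n. *)
have fm : (Wm + (W0 + Wp))%VS = fullv.
  apply/eqP; rewrite eqEdim subvf /= dimvf /dim /= muln1.
  rewrite !dimv_disjoint_sum ?symp_orthogonal_cap // dm d0 dp.
  by rewrite addnA nb_eigen_sum.
have f0 : (W0 + (Wm + Wp))%VS = fullv by rewrite addvA (addvC W0) -addvA.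
have fp : (Wp + (Wm + W0))%VS = fullv by rewrite addvC -addvA.
have invD U V : mxinvariant (J *m A) U -> mxinvariant (J *m A) V ->
    mxinvariant (J *m A) (U + V)%VS.
  by move=> iU iV; rewrite /mxinvariant limgD addvS.
have [Pm [Pmin Pmid Pm0 PmA PmJ]] := symp_projection sm om fm im (invD _ _ i0 ip).
have [P0 [P0in P0id P00 P0A P0J]] := symp_projection s0 o0 f0 i0 (invD _ _ im ip).
have [Pp [Ppin Ppid Pp0 PpA PpJ]] := symp_projection sp op fp ip (invD _ _ im i0).
have sumP (x : 'cV[R]_(n + n)) : Pm *m x + (P0 *m x + Pp *m x) = x.
  have : x \in (Wm + (W0 + Wp))%VS by rewrite fm memvf.
  case/memv_addP => a am [_ /memv_addP[b b0 [c cp ->]] ->].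
  rewrite !mulmxDr (Pmid a) // (P0id b) // (Ppid c) //.
  rewrite (P00 a) ?(P00 c) ?(Pp0 a) ?(Pp0 b) //.
  - by rewrite !(add0r, addr0) -mulmxDr Pm0 ?memv_add // addr0.
  - by rewrite -[b]add0r memv_add ?mem0v.
  - by rewrite -[a]addr0 memv_add ?mem0v.
  - by rewrite -[c]add0r memv_add ?mem0v.
  - by rewrite -[a]addr0 memv_add ?mem0v.
(* Commuting with J A and being self-adjoint for J amounts to being
   self-adjoint for A. *)
have AP P : P *m (J *m A) = J *m A *m P -> P^T *m J = J *m P -> A *m P = P^T *m A.
  move=> PA PJ; apply: oppr_inj; rewrite -[A in LHS]mul1mx -mulNmx -mulNmx -Jmx_sqr.
  rewrite -!mulmxA (mulmxA J A) -PA !mulmxA -PJ -(mulmxA _ J J) Jmx_sqr.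
  by rewrite mulmxN mulmx1 mulNmx.
have PP W (P : 'M[R]_(n + n)) : (forall x, P *m x \in W) ->
    {in W, forall w, P *m w = w} -> P *m P = P.
  by move=> Pin Pid; apply: inner_inj => x y; rewrite -mulmxA Pid.
have AP0 : A *m P0 = 0.
  apply: inner_inj => x y; rewrite -mulmxA mul0mx; congr inner.
  by apply/eqP; rewrite -memP_lker ker.
pose Q := Pp - Pm.
exists (A *m Q + P0^T *m P0); split.
- rewrite linearD /= !trmx_mul trmxK symA linearB /= mulmxBl mulmxBr.
  by rewrite !AP.
- move=> x x0; pose w := x^T.
  have w0 : w != 0 by rewrite trmx_eq0.
  have -> : (x *m (A *m Q + P0^T *m P0) *m x^T) 0 0 =
      inner w ((A *m Q + P0^T *m P0) *m w).
    by rewrite /inner trmxK mulmxA.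
  have quad P W : P *m (J *m A) = J *m A *m P -> P^T *m J = J *m P ->
      (forall x, P *m x \in W) -> {in W, forall w, P *m w = w} ->
      inner w (A *m P *m w) = inner (P *m w) (A *m (P *m w)).
    move=> PA PJ Pin Pid.
    have -> : A *m P *m w = P^T *m (A *m (P *m w)).
      by rewrite -{1}(PP W P Pin Pid) !mulmxA (AP P).
    by rewrite inner_mulr trmxK.
  rewrite mulmxDl mulmxBr mulmxBl !innerDr innerNr (quad _ Wp) // (quad _ Wm) //.
  rewrite -mulmxA [inner w (P0^T *m _)]inner_mulr trmxK.
  have nneg (v : 'cV[R]_(n + n)) (t : R) : (v != 0 -> 0 < t) -> (v = 0 -> t = 0) ->
      0 <= t /\ (t = 0 -> v = 0).
    case: (eqVneq v 0) => [-> _ -> // | _ /(_ isT) t0 _].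
    by split; [exact: ltW | move=> tE; rewrite tE ltxx in t0].
  have [tp0 tp] : 0 <= inner (Pp *m w) (A *m (Pp *m w)) /\
      (inner (Pp *m w) (A *m (Pp *m w)) = 0 -> Pp *m w = 0).
    by apply: nneg => [|->]; [exact: pos | rewrite /inner !mulmx0 mxE].
  have [tm0 tm] : 0 <= - inner (Pm *m w) (A *m (Pm *m w)) /\
      (- inner (Pm *m w) (A *m (Pm *m w)) = 0 -> Pm *m w = 0).
    apply: nneg => [|->]; last by rewrite /inner !mulmx0 mxE oppr0.
    by rewrite -innerNr -mulNmx; exact: neg.
  have [t00 t0] : 0 <= inner (P0 *m w) (P0 *m w) /\
      (inner (P0 *m w) (P0 *m w) = 0 -> P0 *m w = 0).
    split; last exact: inner_eq0.
    by rewrite innerE sumr_ge0 // => i _; rewrite -expr2 sqr_ge0.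
  rewrite lt_def !addr_ge0 // andbT; apply: contra_neq w0 => /eqP.
  rewrite !paddr_eq0 ?addr_ge0 // => /andP[/andP[/eqP/tp wp /eqP/tm wm] /eqP/t0 w0].
  by rewrite -(sumP w) wp wm w0 !addr0.
have QA : Q *m (J *m A) = J *m A *m Q by rewrite mulmxBl mulmxBr PpA PmA.
have JP0 : J *m P0^T = P0 *m J.
  have := congr1 (fun B => J *m B *m J) P0J.
  rewrite -!mulmxA Jmx_sqr (mulmxA J J) Jmx_sqr !mulmxN mulmx1 mulNmx mul1mx.
  exact: oppr_inj.
rewrite mulmxDr !mulmxDl -!mulmxA (mulmxA J P0^T) JP0.
rewrite -(mulmxA P0) (mulmxA A P0) AP0 mul0mx addr0.
rewrite P0A -(mulmxA J) AP0 !mulmx0 addr0 QA.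
by rewrite !mulmxA.
Qed.

End Taming.

Theorem theorem3p1 (R : realType) (n : nat) (A : 'M[R]_(n + n))
    (symA : A^T = A) :
  [/\ (exists (M : 'M[R]_(n + n)) (d : 'rV[R]_n), symp_diagonalizes A M d) <->
      (exists Wm W0 Wp : {vspace 'cV[R]_(n + n)}, symp_splitting A Wm W0 Wp),
      forall (M M' : 'M[R]_(n + n)) (d d' : 'rV[R]_n),
        symp_diagonalizes A M d -> symp_diagonalizes A M' d' ->
        exists s : 'S_n, d' = col_perm s d
    & forall (M : 'M[R]_(n + n)) (d : 'rV[R]_n),
        symp_diagonalizes A M d ->
        eigenvalues_are (iJmx A)
          ([seq (d 0 i)%:C%C | i <- enum 'I_n] ++
           [seq (- d 0 i)%:C%C | i <- enum 'I_n])].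
Proof.
split.
- split=> [[M [d [sM AE]]] | [Wm [W0 [Wp split]]]].
    rewrite block_diag_mx in AE.
    by do 3!eexists; exact: (splitting_of_diagonal symA sM AE).
  have [S [symS posS comm]] := taming_of_splitting symA split.
  exact: (diagonalizable_of_taming symA symS posS comm).
- by move=> M M' d d' dA dA'; exact: (symp_diagonal_unique dA dA').
- by move=> M d; exact: symp_diagonal_spectrum.
Qed.
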